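(* Every $\ell_1$-graph is smooth.
   Context: Graphs are simple and undirected; $d_G$ denotes the shortest path distance of a connected graph $G$. Intervals: $I[u,v]=\{w\in V(G): d_G(u,w)+d_G(w,v)=d_G(u,v)\}$; $N(u)=\{w: d_G(u,w)=1\}$; the step system (step function) of $G$ is $S(u,v)=I[u,v]\cap N(u)$. A connected graph $G$ is smooth if for all vertices $u,v,w,x,y$: $v\in S(u,w)$, $v\in S(u,y)$ and $x\in S(w,y)$ imply $v\in S(u,x)$. A connected graph $G$ is an $\ell_1$-graph if it has a scale-$\lambda$ embedding into a hypercube, i.e., there are $n\ge 1$, a positive integer constant $\lambda$, and a map $\varphi:V(G)\to V(Q_n)$ into the $n$-dimensional hypercube $Q_n$ such that $d_{Q_n}(\varphi(x),\varphi(y))=\lambda\, d_G(x,y)$ for all $x,y\in V(G)$. *)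

(* Defs.v *)
From mathcomp Require Import all_boot.
From mathcomp Require Import boolp classical_sets.

Set Implicit Arguments.
Unset Strict Implicit.
Unset Printing Implicit Defensive.

Local Open Scope nat_scope.
Local Open Scope classical_set_scope.

(* The vertex type is arbitrary: no finiteness is assumed. *)
Record sgraph := SGraph {
  vertex :> Type;
  adj : rel vertex;
  adj_sym : symmetric adj;
  adj_irr : irreflexive adj
}.

Definition has_walk (G : sgraph) (x y : G) (n : nat) : Prop :=
  exists p : seq G, [/\ size p = n, path (@adj G) x p & last x p = y].

Definition connected_graph (G : sgraph) : Prop :=
  forall x y : G, exists n : nat, has_walk x y n.

(* Total function; the junk value 0 occurs only when x and y lie in different
   components, hence never in a connected graph. *)
Definition gdist (G : sgraph) (x y : G) : nat :=
  match pselect (exists n : nat, `[< has_walk x y n >]) with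
  | left ex_walk => ex_minn ex_walk
  | right _ => 0
  end.

Definition geodesic_interval (G : sgraph) (u v : G) : set G :=
  [set w | gdist u w + gdist w v = gdist u v].

Definition neighbors (G : sgraph) (u : G) : set G :=
  [set w | gdist u w = 1].

Definition step (G : sgraph) (u v : G) : set G :=
  geodesic_interval u v `&` neighbors u.

Definition smooth (G : sgraph) : Prop :=
  connected_graph G /\
  forall u v w x y : G,
    v \in step u w -> v \in step u y -> x \in step w y -> v \in step u x.

Definition cube_adj (n : nat) : rel {ffun 'I_n -> bool} :=
  fun a b => #|[set i | a i != b i]%SET| == 1.

Lemma cube_adj_sym (n : nat) : symmetric (@cube_adj n).
Proof.
move=> a b; rewrite /cube_adj; congr (_ == 1).
by apply: eq_card => i; rewrite !inE eq_sym.
Qed.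

Lemma cube_adj_irr (n : nat) : irreflexive (@cube_adj n).
Proof.
move=> a; rewrite /cube_adj (_ : [set i | a i != a i]%SET = finset.set0).
  by rewrite cards0.
by apply/finset.setP => i; rewrite !inE eqxx.
Qed.

Definition hypercube (n : nat) : sgraph :=
  SGraph (@cube_adj_sym n) (@cube_adj_irr n).

Definition l1_graph (G : sgraph) : Prop :=
  connected_graph G /\
  exists (n lambda : nat) (phi : G -> hypercube n),
    [/\ 1 <= n, 0 < lambda &
        forall x y : G, gdist (phi x) (phi y) = lambda * gdist x y].

(* Main.v *)
Require Import Defs.
From mathcomp Require Import all_boot.
From mathcomp Require Import boolp classical_sets.

(** Multiplying all distances by a positive constant does not change which
    triples satisfy the equality [d(u,w) + d(w,v) = d(u,v)], so a
    scale embedding into a hypercube preserves and reflects geodesic intervals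
    ([scale_embedding_interval]).  It remains to work in the hypercube, where
    the distance is the Hamming distance ([gdist_hypercube]) and
    intervals are therefore subcubes: [w] lies between [u] and [v] exactly when
    each coordinate of [w] agrees with that of [u] or that of [v]
    ([hypercube_intervalP]).

    Smoothness then becomes a coordinatewise statement
    ([hypercube_interval_smooth]).  Consider a coordinate [i] at which [u] and
    [v] differ.  As [v] is between [u] and [w], and between [u] and [y], both
    [w] and [y] agree with [v] at [i]; hence so does any [x] between [w] and
    [y].  At each remaining coordinate [v] agrees with [u].  So [v] is between
    [u] and [x]. *)

Local Open Scope nat_scope.

Lemma gdist_eq (G : sgraph) (x y : G) (n : nat) :
  has_walk x y n -> (forall m, has_walk x y m -> n <= m) -> gdist x y = n.
Proof.
move=> wn min_n; rewrite /gdist; case: pselect => [ex_walk|no_walk].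
  case: ex_minnP => m /asboolP wm min_m; apply/eqP.
  by rewrite eqn_leq min_n // min_m //; apply/asboolP.
by case: no_walk; exists n; apply/asboolP.
Qed.

(** The form as a sum, rather than as the cardinal of a set, lets the
    triangle inequality and its equality case be read off termwise. *)
Definition hamming {n : nat} (a b : {ffun 'I_n -> bool}) : nat :=
  \sum_(i < n) (a i != b i).

Lemma cube_adjE n (a b : {ffun 'I_n -> bool}) :
  cube_adj a b = (hamming a b == 1).
Proof.
rewrite /cube_adj /hamming -sum1_card big_mkcond /=; congr (_ == 1).
by apply: eq_bigr => i _; rewrite inE; case: (a i != b i).
Qed.

Lemma hamming_eq0 n (a b : {ffun 'I_n -> bool}) :
  (hamming a b == 0) = (a == b).
Proof.
apply/idP/eqP => [|->]; last by rewrite /hamming big1 // => i _; rewrite eqxx.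
rewrite sum_nat_eq0 => /forallP ab; apply/ffunP => i; apply/eqP.
by move: (ab i); case: (a i == b i).
Qed.

Lemma leqif_hamming n (a b c : {ffun 'I_n -> bool}) :
  hamming a c <= hamming a b + hamming b c
    ?= iff [forall i, (b i == a i) || (b i == c i)].
Proof.
rewrite /hamming -big_split /=; apply: leqif_sum => i _.
by case: (a i); case: (b i); case: (c i).
Qed.

(** A walk changes one coordinate per step, so it has at least as many steps as
    there are coordinates to change. *)
Lemma hamming_le_walk n (a b : hypercube n) m :
  has_walk a b m -> hamming a b <= m.
Proof.
case=> p [<- + <-] {m b}; elim: p a => [|c p IHp] a /=.
  by move=> _; rewrite leqn0 hamming_eq0.
rewrite cube_adjE => /andP [/eqP ac1 /IHp le_p].
by apply: leq_trans (leqif_hamming n a c _) _; rewrite ac1 add1n ltnS.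
Qed.

(** Correcting the differing coordinates one at a time gives a walk of the
    least conceivable length. *)
Lemma hamming_walk n (a b : hypercube n) : has_walk a b (hamming a b).
Proof.
move def_m: (hamming a b) => m; elim: m a def_m => [|m IHm] a ab_m.
  exists [::]; split=> //=; apply/eqP.
  by move/eqP: ab_m; rewrite hamming_eq0.
have [i ab_i] : exists i, a i != b i.
  apply/existsP; apply: contra_eqT ab_m => /existsPn ab.
  by rewrite /hamming big1 // => i _; move: (ab i); case: (a i != b i).
pose c : {ffun 'I_n -> bool} := [ffun j => if j == i then b j else a j].
have ac1 : hamming a c = 1.
  rewrite /hamming (bigD1 i) //= ffunE eqxx ab_i big1 // => j /negbTE ji.
  by rewrite ffunE ji eqxx.
have : hamming a b == hamming a c + hamming c b.
  rewrite (leqif_hamming n a c b); apply/forallP => j; rewrite ffunE.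
  by case: (j == i); rewrite eqxx ?orbT.
rewrite ab_m ac1 add1n eqSS eq_sym => /eqP /IHm [p [sz_p path_p last_p]].
by exists (c :: p); rewrite /= sz_p cube_adjE ac1.
Qed.

Lemma gdist_hypercube n (a b : hypercube n) : gdist a b = hamming a b.
Proof. by apply: gdist_eq (hamming_walk n a b) (hamming_le_walk n a b). Qed.

Lemma hypercube_intervalP n (a b c : hypercube n) :
  geodesic_interval a c b <-> forall i, b i = a i \/ b i = c i.
Proof.
rewrite /geodesic_interval /= !gdist_hypercube; split=> [/esym/eqP | abc].
  by rewrite (leqif_hamming n a b c) => /forallP + i => /(_ i) /orP
    [/eqP|/eqP]; [left|right].
apply/esym/eqP; rewrite (leqif_hamming n a b c); apply/forallP => i.
by case: (abc i) => ->; rewrite eqxx ?orbT.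
Qed.

(** Smoothness with intervals in place of steps.  Steps would be of no use here:
    a scale embedding with constant [lambda] sends adjacent vertices to
    vertices at distance [lambda], adjacent only when [lambda = 1]. *)
Lemma hypercube_interval_smooth n (u v w x y : hypercube n) :
  geodesic_interval u w v -> geodesic_interval u y v ->
  geodesic_interval w y x -> geodesic_interval u x v.
Proof.
move=> /hypercube_intervalP uvw /hypercube_intervalP uvy.
move=> /hypercube_intervalP wxy; apply/hypercube_intervalP => i.
have [|vw] := uvw i; first by left.
have [|vy] := uvy i; first by left.
by right; case: (wxy i) => ->.
Qed.

Lemma scale_embedding_interval (G H : sgraph) (lambda : nat) (phi : G -> H) :
  0 < lambda ->
  (forall x y, gdist (phi x) (phi y) = lambda * gdist x y) ->
  forall u v w : G,
    geodesic_interval (phi u) (phi v) (phi w) <-> geodesic_interval u v w.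
Proof.
move=> lambda_gt0 scale u v w; rewrite /geodesic_interval /= !scale -mulnDr.
by split=> [/eqP|->//]; rewrite eqn_pmul2l // => /eqP.
Qed.

Theorem theorem26 (G : sgraph) : l1_graph G -> smooth G.
Proof.
case=> connG [n [lambda [phi [_ lambda_gt0 scale]]]]; split=> // u v w x y.
have phiI := scale_embedding_interval G _ lambda phi lambda_gt0 scale.
rewrite !inE => -[/phiI uvw uv1] [/phiI uvy _] [/phiI wxy _].
split=> //; apply/phiI; exact: hypercube_interval_smooth uvw uvy wxy.
Qed.
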